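(* Let $(X,d_X,\mathfrak m_X)$, $(Y,d_Y,\mathfrak m_Y)$ be metric measure spaces, with $\mathfrak m_X$, $\mathfrak m_Y$ finite. Let $\mathbb B$ be a universal separable Banach space and let $\varphi\colon X\to Y$ be a Borel map satisfying $\varphi_*\mathfrak m_X=\mathfrak m_Y$. Let $\mathbf E$ be a separable Banach $\mathbb B$-bundle over $Y$. Then $$\varphi^*\Gamma(\mathbf E)\cong\Gamma(\varphi^*\mathbf E),$$ the pullback map $\varphi^*\colon\Gamma(\mathbf E)\to\Gamma(\varphi^*\mathbf E)$ being given by $(\varphi^*s)(x):=s(\varphi(x))$ for $\mathfrak m_X$-a.e. $x\in X$.
   Context: A metric measure space is a complete separable metric space with a non-negative Radon measure; $X$ and $Y$ are regarded as measurable spaces with their Borel $\sigma$-algebras. Banach spaces are real. For a $\sigma$-finite measure space $(X,\Sigma,\mathfrak m)$, $L^0(\mathfrak m)$ is the ring of $\mathfrak m$-a.e. equivalence classes of measurable functions $X\to\mathbb R$, with distance $d_{L^0(\mathfrak m)}(f,g)=\int\min\{|f-g|,1\}\,d\mathfrak m'$, where $\mathfrak m'$ is a fixed probability measure with $\mathfrak m\ll\mathfrak m'\ll\mathfrak m$. A normed $L^0(\mathfrak m)$-module is a couple $(\mathscr M,|\cdot|)$ where $\mathscr M$ is an algebraic $L^0(\mathfrak m)$-module, $|\cdot|\colon\mathscr M\to L^0(\mathfrak m)$ satisfies, $\mathfrak m$-a.e., $|v|\ge0$ with equality iff $v=0$, $|v+w|\le|v|+|w|$, $|f\cdot v|=|f||v|$,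 and the distance $d_{\mathscr M}(v,w):=d_{L^0(\mathfrak m)}(|v-w|,0)$ is complete. A set generates $\mathscr M$ if the smallest algebraic $L^0(\mathfrak m)$-submodule containing it is $d_{\mathscr M}$-dense. Isomorphisms are $L^0(\mathfrak m)$-linear bijections preserving the pointwise norm. Pullback module: if $\mathscr M$ is a normed $L^0(\mathfrak m_Y)$-module and $\varphi\colon X\to Y$ is measurable with $\varphi_*\mathfrak m_X\ll\mathfrak m_Y$, then $(\varphi^*\mathscr M,\varphi^* )$ is the couple, unique up to unique isomorphism, such that $\varphi^*\mathscr M$ is a normed $L^0(\mathfrak m_X)$-module, $\varphi^*\colon\mathscr M\to\varphi^*\mathscr M$ is linear, $|\varphi^*v|=|v|\circ\varphi$ $\mathfrak m_X$-a.e. for all $v\in\mathscr M$, and $\{\varphi^*v:v\in\mathscr M\}$ generates $\varphi^*\mathscr M$. The claim says that $\Gamma(\varphi^*\mathbf E)$ together with the map $s\mapsto s\circ\varphi$ is (isomorphic to) the pullback of $\Gamma(\mathbf E)$. Bundles: a universal separable Banach space is a separable Banach space $\mathbb B$ into which every separable Banach space embeds linearly and isometrically. $\mathrm{Gr}(\mathbb B)$ is the family of closed linear subspaces of $\mathbb B$. A separable Banach $\mathbb B$-bundle over a measurable space $(Y,\Sigma_Y)$ is a map $\mathbf E\colon Y\to\mathrm{Gr}(\mathbb B)$ such that $\{y\in Y:\mathbf E(y)\cap U\ne\emptyset\}\in\Sigma_Y$ for every open $U\subseteq\mathbb B$. $\Gamma(\mathbf E)$ is the space of measurable maps $\bar s\colon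 Y\to\mathbb B$ with $\bar s(y)\in\mathbf E(y)$ for all $y$, modulo $\mathfrak m_Y$-a.e. equality, a normed $L^0(\mathfrak m_Y)$-module with pointwise norm $|s|(y)=\|s(y)\|_{\mathbb B}$. The pullback bundle $\varphi^*\mathbf E\colon X\to\mathrm{Gr}(\mathbb B)$ is $\varphi^*\mathbf E(x):=\mathbf E(\varphi(x))$, a separable Banach $\mathbb B$-bundle over $X$; $\Gamma(\varphi^*\mathbf E)$ is defined similarly using $\mathfrak m_X$. *)

(* Defs.v *)
From HB Require Import structures.
From mathcomp Require Import all_boot all_order all_algebra generic_quotient.
From mathcomp Require Import all_classical all_reals all_analysis.
From mathcomp Require Import measurable_realfun.

Set Implicit Arguments.
Unset Strict Implicit.
Unset Printing Implicit Defensive.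
Import Order.TTheory GRing.Theory Num.Theory.
Import numFieldNormedType.Exports.

Local Open Scope classical_set_scope.
Local Open Scope quotient_scope.
Local Open Scope ring_scope.

Definition separable (T : topologicalType) : Prop :=
  exists2 D : set T, countable D & dense D.

#[short(type="completeMetricType")]
HB.structure Definition CompleteMetric (R : realType) :=
  {T of Metric R T & Complete T}.

HB.mixin Record isSeparable T & Topological T := {
  separableT : separable T
}.

#[short(type="separableBanachType")]
HB.structure Definition SeparableBanach (R : realType) :=
  {T of CompleteNormedModule R T & isSeparable T}.

(* A type alias: [borel T] is convertible to [T] but carries only the pointed
   and measurable structures of [T]. *)
Notation borel T := (g_sigma_algebraType (@open T)).

Definition radon (R : realType) (T : ptopologicalType)
    (mu : set (borel T) -> \bar R) : Prop :=
  (forall x : T, exists2 U : set T, open U /\ U x & (mu U < +oo)%E) /\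
  (forall A : set (borel T), measurable A ->
     mu A = ereal_sup [set mu K | K in [set K : set T | compact K /\ K `<=` A]]).

Section L0.
Context d (T : measurableType d) (R : realType).
Variable mu : {measure set T -> \bar R}.

Definition L0 : Type := {mfun_ mu, T >-> R}.
HB.instance Definition _ := Choice.on L0.
HB.instance Definition _ := EqQuotient.on L0.

Definition L0_fun (f : L0) : T -> R := repr f.
Coercion L0_fun : L0 >-> Funclass.

Implicit Types f g : {mfun T >-> R}.

Lemma L0_piP f g : \pi_L0 f = \pi_L0 g <-> (f : T -> R) = g %[ae mu].
Proof.
split=> [/eqquotP/asboolP//|fg]; exact/eqquotP/asboolP.
Qed.

Lemma L0_reprP f : L0_fun (\pi_L0 f) = f %[ae mu].
Proof. by apply/L0_piP; rewrite reprK. Qed.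

Definition L0_cst (a : R) : L0 := \pi_L0 (cst a : {mfun T >-> R}).

Let zero : L0 := \pi_L0 0.
Let one : L0 := \pi_L0 1.
Let opp : L0 -> L0 := lift_op1 L0 (fun f => - f).
Let add : L0 -> L0 -> L0 := lift_op2 L0 (fun f g => f + g).
Let mul : L0 -> L0 -> L0 := lift_op2 L0 (fun f g => f * g).

Let pi_opp : {morph \pi_L0 : f / - f >-> opp f}.
Proof.
move=> f; unlock opp; apply/esym/L0_piP.
by apply: filterS (L0_reprP f) => x; rewrite !mfunN /L0_fun/= => ->.
Qed.

Let pi_add : {morph \pi_L0 : f g / f + g >-> add f g}.
Proof.
move=> f g; unlock add; apply/esym/L0_piP.
apply: filterS2 (L0_reprP f) (L0_reprP g) => x.
by rewrite !mfunD /L0_fun/= => -> // ->.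
Qed.

Let pi_mul : {morph \pi_L0 : f g / f * g >-> mul f g}.
Proof.
move=> f g; unlock mul; apply/esym/L0_piP.
apply: filterS2 (L0_reprP f) (L0_reprP g) => x.
by rewrite !mfunM /L0_fun/= => -> // ->.
Qed.

Let addA : associative add.
Proof.
elim/quotW => f; elim/quotW => g; elim/quotW => h.
by rewrite -!pi_add GRing.addrA.
Qed.

Let addC : commutative add.
Proof.
by elim/quotW => f; elim/quotW => g; rewrite -!pi_add GRing.addrC.
Qed.

Let add0 : left_id zero add.
Proof. by elim/quotW => f; rewrite -pi_add add0r. Qed.

Let addN : left_inverse zero opp add.
Proof. by elim/quotW => f; rewrite -pi_opp -pi_add addNr. Qed.

Let mulA : associative mul.
Proof.
elim/quotW => f; elim/quotW => g; elim/quotW => h.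
by rewrite -!pi_mul GRing.mulrA.
Qed.

Let mulC : commutative mul.
Proof.
by elim/quotW => f; elim/quotW => g; rewrite -!pi_mul GRing.mulrC.
Qed.

Let mul1 : left_id one mul.
Proof. by elim/quotW => f; rewrite -pi_mul mul1r. Qed.

Let mulDl : left_distributive mul add.
Proof.
elim/quotW => f; elim/quotW => g; elim/quotW => h.
by rewrite -!pi_add -!pi_mul -pi_add GRing.mulrDl.
Qed.

(* [L0] is only a [comPzRingType]: it is the zero ring when [mu] is zero. *)
HB.instance Definition _ := GRing.isZmodule.Build L0 addA addC add0 addN.
HB.instance Definition _ :=
  GRing.Zmodule_isComPzRing.Build L0 mulA mulC mul1 mulDl.

Lemma L0_pi0 : \pi_L0 0 = 0. Proof. by []. Qed.
Lemma L0_pi1 : \pi_L0 1 = 1. Proof. by []. Qed.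
Lemma L0_piN f : \pi_L0 (- f) = - \pi_L0 f. Proof. exact: pi_opp. Qed.
Lemma L0_piD f g : \pi_L0 (f + g) = \pi_L0 f + \pi_L0 g.
Proof. exact: pi_add. Qed.
Lemma L0_piM f g : \pi_L0 (f * g) = \pi_L0 f * \pi_L0 g.
Proof. exact: pi_mul. Qed.

(* [mu'] must be equivalent to [mu] ([equivalent_measures]) for this distance to
   be independent of the choice of representatives. *)
Definition L0_dist (mu' : probability T R) (f g : L0) : \bar R :=
  (\int[mu']_x (Num.min `|f x - g x| 1)%:E)%E.

End L0.

Definition is_submodule (A : pzRingType) (V : lmodType A) (S : set V) : Prop :=
  S 0 /\ forall (a : A) (u v : V), S u -> S v -> S (a *: u + v).

Definition equivalent_measures d (T : measurableType d) (R : realType)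
    (mu nu : set T -> \bar R) : Prop := mu `<< nu /\ nu `<< mu.

Section normed_L0_module.
Context d (T : measurableType d) (R : realType).
Variables (mu : {measure set T -> \bar R}) (mu' : probability T R).

Definition module_dist (M : lmodType (L0 mu)) (norm : M -> L0 mu) (v w : M) :=
  L0_dist mu' (norm (v - w)) 0.

Record normed_L0_module (M : lmodType (L0 mu)) (norm : M -> L0 mu) : Prop := {
  norm_ge0 : forall v, \forall x \ae mu, 0 <= norm v x ;
  norm_eq0 : forall v, (\forall x \ae mu, norm v x = 0) <-> v = 0 ;
  norm_triangle : forall v w,
    \forall x \ae mu, norm (v + w) x <= norm v x + norm w x ;
  norm_scale : forall (f : L0 mu) v,
    \forall x \ae mu, norm (f *: v) x = `|f x| * norm v x ;
  norm_complete : forall u : nat -> M,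
    (forall e : R, 0 < e -> exists n0, forall i j, (n0 <= i)%N -> (n0 <= j)%N ->
       (module_dist norm (u i) (u j) < e%:E)%E) ->
    exists v, module_dist norm (u n) v @[n --> \oo] --> 0%E
}.

Definition generates (M : lmodType (L0 mu)) (norm : M -> L0 mu) (S : set M) :=
  forall (v : M) (e : R), 0 < e ->
    exists2 w, smallest (@is_submodule _ M) S w &
               (module_dist norm v w < e%:E)%E.

Definition module_isomorphism (M N : lmodType (L0 mu))
    (normM : M -> L0 mu) (normN : N -> L0 mu) (Phi : {linear M -> N}) : Prop :=
  bijective Phi /\ forall v, normN (Phi v) = normM v.

End normed_L0_module.

Record is_pullback dX dY (X : measurableType dX) (Y : measurableType dY)
    (R : realType) (muX : {measure set X -> \bar R})
    (muY : {measure set Y -> \bar R}) (muX' : probability X R)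
    (muY' : probability Y R) (phi : {mfun X >-> Y})
    (M : lmodType (L0 muY)) (normM : M -> L0 muY)
    (N : lmodType (L0 muX)) (normN : N -> L0 muX) (pb : M -> N) : Prop := {
  pullback_source : normed_L0_module muY' normM ;
  pullback_target : normed_L0_module muX' normN ;
  (* real linearity: [M] and [N] are modules over different rings *)
  pullback_linear : forall (a : R) v w,
    pb (L0_cst muY a *: v + w) = L0_cst muX a *: pb v + pb w ;
  pullback_norm : forall v, \forall x \ae muX, normN (pb v) x = normM v (phi x) ;
  pullback_generates : generates muX' normN (range pb)
}.

Section bundle.
Context (R : realType) (B : separableBanachType R).

Definition universal : Prop :=
  forall V : separableBanachType R,
    exists iota : {linear V -> B}, forall v, `|iota v| = `|v|.

Record Gr := GrSubspace {
  gr_set :> set B ;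
  gr_closed : closed gr_set ;
  gr_submodule : is_submodule gr_set
}.

Record banach_bundle d (Y : measurableType d) := BanachBundle {
  fiber :> Y -> Gr ;
  fiber_measurable : forall U : set B, open U ->
    measurable [set y | fiber y `&` U !=set0]
}.

End bundle.

Section pullback_bundle.
Context (R : realType) (B : separableBanachType R).
Context dX dY (X : measurableType dX) (Y : measurableType dY).
Variables (phi : {mfun X >-> Y}) (E : banach_bundle B Y).

Let pullback_fiber_measurable (U : set B) : open U ->
  measurable [set x | E (phi x) `&` U !=set0].
Proof.
move=> oU; rewrite -[X in measurable X]setTI.
exact: (measurable_funP phi measurableT _ (fiber_measurable E oU)).
Qed.

Definition pullback_bundle : banach_bundle B X :=
  @BanachBundle _ _ _ X (E \o phi) pullback_fiber_measurable.

End pullback_bundle.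

Section borel_measurability.
Context d (T : measurableType d) (R : realType).

Lemma measurable_borelP (W : ptopologicalType) (f : T -> W) :
  measurable_fun setT (f : T -> borel W) <->
  forall U : set W, open U -> measurable (f @^-1` U).
Proof.
split=> [mf U oU|mf].
  by rewrite -[_ @^-1` _]setTI; apply: mf => //; exact: sub_sigma_algebra.
apply: (@measurability _ _ T (borel W) setT f (@open W)) => // _ [U oU <-].
by rewrite setTI; exact: mf.
Qed.

Lemma dense_ball (S : pseudoMetricType R) (E : set S) (y : S) (r : R) :
  dense E -> 0 < r ->
  exists2 a, E a & ((ball a r)^° y /\ ball a r `<=` ball y (r + r)).
Proof.
move=> dE r0; have r20 : 0 < r / 2 by rewrite divr_gt0.
have [a [ya Ea]] : (ball y (r / 2))^° `&` E !=set0.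
  apply: dE; last exact: open_interior.
  by exists y; exact: nbhsx_ballx.
have {}ya : ball y (r / 2) a := interior_subset ya.
exists a => //; split.
  apply/nbhs_ballP; exists (r / 2) => //= z yz.
  by rewrite [r]splitr; apply: ball_triangle yz; exact: ball_sym.
move=> z az; apply: ball_triangle az; apply: le_ball ya.
by rewrite ler_pdivrMr// ler_peMr ?ler1n// ltW.
Qed.

Lemma measurable_comp2 (U V : pseudoMetricType R) (W : ptopologicalType)
    (f : T -> U) (g : T -> V) (h : U * V -> W) :
  separable U -> separable V -> continuous h ->
  (forall O : set U, open O -> measurable (f @^-1` O)) ->
  (forall O : set V, open O -> measurable (g @^-1` O)) ->
  measurable_fun setT ((fun x => h (f x, g x)) : T -> borel W).
Proof.
move=> [D cD dD] [D' cD' dD'] ch mf mg; apply/measurable_borelP => O oO.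
pose r (n : nat) : R := n.+1%:R^-1.
pose I := [set p : U * V * nat | (D `*` D' `*` [set: nat]) p /\
  ball p.1.1 (r p.2) `*` ball p.1.2 (r p.2) `<=` h @^-1` O].
have -> : (fun x => h (f x, g x)) @^-1` O =
    \bigcup_(p in I) (f @^-1` (ball p.1.1 (r p.2))^° `&`
                      g @^-1` (ball p.1.2 (r p.2))^°).
  apply/seteqP; split=> [x /= Ox|x [p [_ sub] [/= fx gx]]]; last first.
    by apply: (sub (f x, g x)); split; exact: interior_subset.
  have : nbhs (f x, g x) (h @^-1` O) by apply: ch; exact: open_nbhs_nbhs.
  move=> [[A A'] /= [/nbhs_ballP[e /= e0 eA] /nbhs_ballP[e' /= e'0 eA']] sub].
  have m0 : 0 < Num.min e e' by rewrite lt_min e0.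
  have [n nm] : exists n, r n < Num.min e e' / 2.
    have := near_infty_natSinv_lt (PosNum (divr_gt0 m0 (ltr0Sn _ 1))).
    by move=> [n _ /(_ n (leqnn n))]; exists n.
  have rnm : r n + r n <= Num.min e e' by rewrite [leRHS]splitr lerD// ltW.
  have r0 : 0 < r n by rewrite invr_gt0.
  have [a Da [fa aU]] := dense_ball (f x) dD r0.
  have [b Db [gb bV]] := dense_ball (g x) dD' r0.
  exists (a, b, n); split => //= -[u v] [/= au bv].
  apply: (sub (u, v)); split; [apply: eA|apply: eA'] => /=.
    by apply: le_ball (aU _ au); rewrite (le_trans rnm)// ge_min lexx.
  by apply: le_ball (bV _ bv); rewrite (le_trans rnm)// ge_min lexx orbT.
have : countable I.
  apply: (@sub_countable _ _ _ (D `*` D' `*` [set: nat])).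
    by apply: subset_card_le => p [].
  by apply: countableX => //; exact: countableX.
move=> /countable_injP[k kinj].
set F := fun p : U * V * nat => _ `&` _.
have -> : \bigcup_(p in I) F p =
    \bigcup_n \bigcup_(p in [set p | I p /\ k p = n]) F p.
  apply/seteqP; split=> [x [p Ip Fp]|x [n _ [p [Ip _] Fp]]]; last by exists p.
  by exists (k p) => //; exists p.
apply: bigcupT_measurable => n.
have [[p [Ip kp]]|np] := pselect (exists p, I p /\ k p = n); last first.
  by rewrite bigcup0// => p Ip; case: np; exists p.
rewrite (_ : [set p | _] = [set p]) ?bigcup_set1; last first.
  apply/seteqP; split=> [q [Iq kq]|_ ->//].
  by apply: kinj; rewrite ?inE// kq.
by apply: measurableI; [apply: mf|apply: mg]; exact: open_interior.
Qed.

End borel_measurability.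

Section sections.
Context (R : realType) (B : separableBanachType R).
Context d (Y : measurableType d) (E : banach_bundle B Y).

Record bundle_section := BundleSection {
  section_fun :> Y -> B ;
  section_measurable : measurable_fun setT (section_fun : Y -> borel B) ;
  section_fiber : forall y, (E y : set B) (section_fun y)
}.

HB.instance Definition _ := gen_eqMixin bundle_section.
HB.instance Definition _ := gen_choiceMixin bundle_section.

Lemma bundle_sectionP (s t : bundle_section) : s =1 t -> s = t.
Proof.
case: s t => [s ms sE] [t mt tE] /= /funext st; case: _ / st mt tE => mt tE.
by congr BundleSection; exact: Prop_irrelevance.
Qed.

Implicit Types (s t : bundle_section) (f : {mfun Y >-> R}).

Let Gr0 y : (E y : set B) 0. Proof. by case: (gr_submodule (E y)). Qed.

Let GrDZ y (a : R) u v :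
  (E y : set B) u -> (E y : set B) v -> (E y : set B) (a *: u + v).
Proof. by case: (gr_submodule (E y)) => _; exact. Qed.

Let borel_preimage s (O : set B) : open O -> measurable (s @^-1` O).
Proof. by move: O; apply/measurable_borelP/section_measurable. Qed.

Let add_measurable s t :
  measurable_fun setT ((fun y => s y + t y) : Y -> borel B).
Proof.
apply: (@measurable_comp2 _ _ _ _ _ _ s t (fun p : B * B => p.1 + p.2));
  try exact: separableT; try exact: borel_preimage.
exact: add_continuous.
Qed.

Let R_separable : separable R.
Proof.
exists (range (ratr : rat -> R)); last exact: dense_rat.
apply: (sub_countable (card_image_le _ _)); exact: countableP.
Qed.

Let scale_measurable f s :
  measurable_fun setT ((fun y => f y *: s y) : Y -> borel B).
Proof.
apply: (@measurable_comp2 _ _ _ _ _ _ f s (fun p : R^o * B => p.1 *: p.2));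
  try exact: separableT; try exact: R_separable; try exact: borel_preimage.
  exact: scale_continuous.
move=> O oO; rewrite -[_ @^-1` _]setTI.
by apply: (measurable_funP f) => //; exact: open_measurable.
Qed.

Definition section0 : bundle_section :=
  @BundleSection (fun=> 0) (@measurable_cst _ _ _ (borel B) setT 0) Gr0.

Let add_fiber s t y : (E y : set B) (s y + t y).
Proof. by rewrite -[s y]scale1r; apply: GrDZ; exact: section_fiber. Qed.

Let scale_fiber f s y : (E y : set B) (f y *: s y).
Proof. by rewrite -[_ *: _]addr0; apply: GrDZ => //; exact: section_fiber. Qed.

Definition sectionD s t : bundle_section :=
  @BundleSection (fun y => s y + t y) (add_measurable s t) (add_fiber s t).

Definition sectionZ f s : bundle_section :=
  @BundleSection (fun y => f y *: s y) (scale_measurable f s)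
    (scale_fiber f s).

Definition section_norm_fun s : Y -> R := fun y => `|s y|.

Let norm_measurable s : measurable_fun setT (section_norm_fun s).
Proof.
apply: (measurability _ (RGenOpens.measurableE R)) => // _ [_ [a [b ->]] <-].
rewrite setTI; apply: (@borel_preimage s (@Num.norm R B @^-1` `]a, b[%classic)).
by apply: open_comp; [move=> x _; exact: norm_continuous|exact: interval_open].
Qed.

HB.instance Definition _ s :=
  isMeasurableFun.Build _ _ _ _ (section_norm_fun s) (norm_measurable s).

Definition section_norm s : {mfun Y >-> R} := section_norm_fun s.

Section quotient.
Variable mu : {measure set Y -> \bar R}.

Definition section_eq s t := `[< (s : Y -> B) = t %[ae mu] >].

Let section_eq_refl : reflexive section_eq.
Proof. by move=> s; exact/asboolP/ae_eq_refl. Qed.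

Let section_eq_sym : symmetric section_eq.
Proof. by move=> s t; apply/idP/idP => /asboolP h; exact/asboolP/ae_eq_sym. Qed.

Let section_eq_trans : transitive section_eq.
Proof.
by move=> s t u /asboolP h /asboolP h'; exact/asboolP/(ae_eq_trans h h').
Qed.

Canonical section_eq_equiv :=
  EquivRel section_eq section_eq_refl section_eq_sym section_eq_trans.

Definition Gamma : Type := {eq_quot section_eq}.
HB.instance Definition _ := Choice.on Gamma.
HB.instance Definition _ := EqQuotient.on Gamma.

Definition Gamma_fun (s : Gamma) : Y -> B := repr s.

Lemma Gamma_piP s t : \pi_Gamma s = \pi_Gamma t <-> (s : Y -> B) = t %[ae mu].
Proof.
split=> [/eqquotP/asboolP//|fg]; exact/eqquotP/asboolP.
Qed.

Lemma Gamma_reprP s : Gamma_fun (\pi_Gamma s) = s %[ae mu].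
Proof. by apply/Gamma_piP; rewrite reprK. Qed.

Let zero : Gamma := \pi_Gamma section0.
Let opp : Gamma -> Gamma := lift_op1 Gamma (sectionZ (-1)).
Let add : Gamma -> Gamma -> Gamma := lift_op2 Gamma sectionD.

Definition Gamma_scale (f : L0 mu) (s : Gamma) : Gamma :=
  \pi_Gamma (sectionZ (repr f) (repr s)).

Definition Gamma_norm (s : Gamma) : L0 mu :=
  \pi_(L0 mu) (section_norm (repr s)).

Let pi_opp : {morph \pi_Gamma : s / sectionZ (-1) s >-> opp s}.
Proof.
move=> s; unlock opp; apply/esym/Gamma_piP.
by apply: filterS (Gamma_reprP s) => y; rewrite /Gamma_fun/= => ->.
Qed.

Let pi_add : {morph \pi_Gamma : s t / sectionD s t >-> add s t}.
Proof.
move=> s t; unlock add; apply/esym/Gamma_piP.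
apply: filterS2 (Gamma_reprP s) (Gamma_reprP t) => y.
by rewrite /Gamma_fun/= => -> // ->.
Qed.

Lemma Gamma_piZ f s :
  \pi_Gamma (sectionZ f s) = Gamma_scale (\pi_(L0 mu) f) (\pi_Gamma s).
Proof.
apply/esym/Gamma_piP.
apply: filterS2 (L0_reprP mu f) (Gamma_reprP s) => y.
by rewrite /L0_fun /Gamma_fun/= => -> // ->.
Qed.

Lemma Gamma_norm_pi s : Gamma_norm (\pi_Gamma s) = \pi_(L0 mu) (section_norm s).
Proof.
apply/L0_piP; apply: filterS (Gamma_reprP s) => y.
by rewrite /Gamma_fun/= /section_norm_fun => ->.
Qed.

Let addA : associative add.
Proof.
elim/quotW => s; elim/quotW => t; elim/quotW => u.
by rewrite -!pi_add; congr \pi; apply: bundle_sectionP => y; exact: addrA.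
Qed.

Let addC : commutative add.
Proof.
elim/quotW => s; elim/quotW => t.
by rewrite -!pi_add; congr \pi; apply: bundle_sectionP => y; exact: addrC.
Qed.

Let add0 : left_id zero add.
Proof.
elim/quotW => s.
by rewrite -pi_add; congr \pi; apply: bundle_sectionP => y; exact: add0r.
Qed.

Let addN : left_inverse zero opp add.
Proof.
elim/quotW => s; rewrite -pi_opp -pi_add; congr \pi.
by apply: bundle_sectionP => y /=; rewrite scaleN1r addNr.
Qed.

HB.instance Definition _ := GRing.isZmodule.Build Gamma addA addC add0 addN.

Lemma Gamma_pi0 : \pi_Gamma section0 = 0. Proof. by []. Qed.
Lemma Gamma_piD s t : \pi_Gamma (sectionD s t) = \pi_Gamma s + \pi_Gamma t.
Proof. exact: pi_add. Qed.

Let scaleA (f g : L0 mu) (s : Gamma) :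
  Gamma_scale f (Gamma_scale g s) = Gamma_scale (f * g) s.
Proof.
elim/quotW: f => f; elim/quotW: g => g; elim/quotW: s => s.
rewrite -(Gamma_piZ g s) -(Gamma_piZ f) -L0_piM -Gamma_piZ; congr \pi.
by apply: bundle_sectionP => y; rewrite /= scalerA.
Qed.

Let scale1 : left_id 1 Gamma_scale.
Proof.
elim/quotW => s; rewrite -L0_pi1 -Gamma_piZ; congr \pi.
by apply: bundle_sectionP => y; rewrite /= scale1r.
Qed.

Let scaleDr : right_distributive Gamma_scale +%R.
Proof.
elim/quotW => f; elim/quotW => s; elim/quotW => t.
rewrite -(Gamma_piZ f s) -(Gamma_piZ f t) -!Gamma_piD -Gamma_piZ; congr \pi.
by apply: bundle_sectionP => y; rewrite /= scalerDr.
Qed.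

Let scaleDl (s : Gamma) : {morph Gamma_scale^~ s : f g / f + g}.
Proof.
elim/quotW => f; elim/quotW => g; elim/quotW: s => s.
rewrite -L0_piD -(Gamma_piZ _ s) -(Gamma_piZ f) -(Gamma_piZ g) -Gamma_piD; congr \pi.
by apply: bundle_sectionP => y; rewrite /= scalerDl.
Qed.

HB.instance Definition _ := GRing.Zmodule_isLmodule.Build (L0 mu) Gamma
  scaleA scale1 scaleDr scaleDl.

End quotient.
End sections.

(* Main.v *)
Require Import Defs.
From HB Require Import structures.
From mathcomp Require Import all_boot all_order all_algebra generic_quotient.
From mathcomp Require Import all_classical all_reals all_analysis.
From mathcomp Require Import measurable_realfun lra.

(** It suffices to show that [Gamma (pullback_bundle phi E)], with the map
    [s |-> s \o phi], is a pullback of [Gamma E], and that any two pullbacks are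
    isomorphic.

    Generation: a selection argument gives countably many sections [s_k] of [E]
    such that every vector of every fibre [E y] is within [e] of some [s_k y]. A
    section of the pullback bundle is then within [e] of a gluing of the
    [s_k \o phi] along a countable measurable cover of [X], and finitely many
    pieces exhaust the measure up to [e].

    Uniqueness: call [n] in [N1] and [g] in [N2] related if, for one sequence [w]
    of elements of [M], at almost every point [n] and [g] are simultaneously
    approximated by the [pb1 (w j)] and [pb2 (w j)]. Related elements have the
    same pointwise norm, as [pb1] and [pb2] both preserve it; scalars in [L0] may
    be replaced by rational ones at each point, so the relation is
    [L0]-linear; and it is closed. It is therefore the graph of an isomorphism. *)

Set Implicit Arguments.
Unset Strict Implicit.
Unset Printing Implicit Defensive.
Import Order.TTheory GRing.Theory Num.Theory.
Import numFieldNormedType.Exports.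

Local Open Scope classical_set_scope.
Local Open Scope quotient_scope.
Local Open Scope ring_scope.

(** * The size of a function in measure *)

Section size_in_measure.
Context d (T : measurableType d) (R : realType) (P : probability T R).
Implicit Types (h k l : T -> R).

(** The distance from [h] to zero in [L0], taken on plain functions so that it also applies to
    expressions in representatives. *)
Definition L0size h : \bar R := (\int[P]_x (Num.min `|h x| 1)%:E)%E.

Let trunc_measurable h : measurable_fun setT h ->
  measurable_fun setT (fun x => (Num.min `|h x| 1)%:E).
Proof.
move=> mh; apply/measurable_EFinP; apply: measurable_minr => //.
exact: measurableT_comp.
Qed.

Let trunc_ge0 h x : 0 <= Num.min `|h x| 1.
Proof. by rewrite le_min normr_ge0 ler01. Qed.

Lemma L0size_ge0 h : (0 <= L0size h)%E.
Proof. by apply: integral_ge0 => x _; rewrite lee_fin. Qed.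

Lemma L0size_le h k : measurable_fun setT h -> measurable_fun setT k ->
  (\forall x \ae P, `|h x| <= `|k x|) -> (L0size h <= L0size k)%E.
Proof.
move=> mh mk hk; apply: ae_ge0_le_integral => //;
  try (by move=> x _; rewrite lee_fin); try exact: trunc_measurable.
apply: filterS hk => x hk _; rewrite lee_fin.
by rewrite le_min !ge_min hk lexx orbT.
Qed.

Lemma L0size_ae_eq h k : measurable_fun setT h -> measurable_fun setT k ->
  (\forall x \ae P, h x = k x) -> L0size h = L0size k.
Proof.
move=> mh mk hk; apply/eqP; rewrite eq_le !L0size_le//.
  by apply: filterS hk => x ->.
by apply: filterS hk => x ->.
Qed.

Lemma L0sizeD_le h k l : measurable_fun setT h -> measurable_fun setT k ->
  measurable_fun setT l -> (\forall x \ae P, `|h x| <= `|k x| + `|l x|) ->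
  (L0size h <= L0size k + L0size l)%E.
Proof.
move=> mh mk ml hkl; rewrite /L0size -ge0_integralD//;
  try (by move=> x _; rewrite lee_fin); try exact: trunc_measurable.
apply: ae_ge0_le_integral => //;
  try (by move=> x _; rewrite lee_fin ?addr_ge0); try exact: trunc_measurable.
  by apply: emeasurable_funD; exact: trunc_measurable.
apply: filterS hkl => x hkl _; rewrite -EFinD lee_fin.
have k0 := normr_ge0 (k x); have l0 := normr_ge0 (l x).
by case: (ltP `|h x| 1); case: (ltP `|k x| 1); case: (ltP `|l x| 1); lra.
Qed.

(** For [e <= 1] the truncation at 1 does not change the set where [e] is reached, so Markov's
    inequality for the truncated function applies. *)
Lemma L0size_chebyshev h (e : R) : measurable_fun setT h -> 0 < e <= 1 ->
  (P [set x | (e <= `|h x|)%R] <= e^-1%:E * L0size h)%E.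
Proof.
move=> mh /andP[e0 e1]; rewrite -lee_pdivrMl// ?invr_gt0// invrK.
have := le_integral_abse P measurableT (trunc_measurable mh) e0.
under eq_integral do rewrite gee0_abs ?lee_fin//.
rewrite setTI; congr (_ * P _ <= _)%E; apply/funext => x /=.
by rewrite lee_fin (ger0_norm (trunc_ge0 _ _)) le_min e1 andbT.
Qed.

Lemma le_norm_measurable h (e : R) : measurable_fun setT h ->
  measurable [set x | e <= `|h x|].
Proof.
move=> mh; rewrite -[X in measurable X]setTI.
by apply: measurable_fun_le => //; exact: measurableT_comp.
Qed.

(** By Chebyshev, the set where every [|h_ n|] is at least [e] has arbitrarily small measure, hence
    is null. The index found may depend on the point, so no subsequence is extracted. *)
Lemma L0size_inf (h_ : nat -> T -> R) :
  (forall n, measurable_fun setT (h_ n)) ->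
  (forall e : R, 0 < e -> exists n, (L0size (h_ n) < e%:E)%E) ->
  \forall x \ae P, forall e : R, 0 < e -> exists n, `|h_ n x| < e.
Proof.
move=> mh h0.
suff : \forall x \ae P, forall m : nat, exists n, `|h_ n x| < m.+1%:R^-1.
  apply: filterS => x hx e e0.
  have [m _ /(_ m (leqnn m)) me] := near_infty_natSinv_lt (PosNum e0).
  by have [n hn] := hx m; exists n; exact: lt_trans hn me.
apply: ae_foralln => m; set e : R := m.+1%:R^-1.
have e01 : 0 < e <= 1 by rewrite invr_gt0 ltr0n invf_le1 ?ltr0n// ler1n.
have e0 : 0 < e by case/andP: e01.
pose A := \bigcap_n [set x | e <= `|h_ n x|].
have mA : measurable A.
  by apply: bigcapT_measurable => n; exact: le_norm_measurable.
exists A; split => //; last first.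
  move=> x /= hx n _ /=; rewrite leNgt; apply/negP => hn.
  by apply: hx; exists n.
apply/eqP; rewrite eq_le measure_ge0 andbT; apply/lee_addgt0Pr => r r0.
rewrite add0e; have [n hn] := h0 _ (mulr_gt0 e0 r0).
apply: (@le_trans _ _ (P [set x | e <= `|h_ n x|])).
  by apply: le_measure; rewrite ?inE//; [exact: le_norm_measurable|move=> x; exact].
apply: le_trans (L0size_chebyshev (mh n) e01) _.
by rewrite lee_pdivrMl// -EFinM ltW.
Qed.

Lemma L0size_bound h (A : set T) (a : R) :
  measurable_fun setT h -> measurable A -> 0 <= a -> (\forall x \ae P, A x -> `|h x| <= a) ->
  (L0size h <= a%:E + P (~` A))%E.
Proof.
move=> mh mA a0 hA.
have mi : measurable_fun setT (fun x => (\1_(~` A) x : R)%:E).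
  by apply/measurable_EFinP; apply: measurable_indic; exact: measurableC.
have -> : (a%:E + P (~` A) = \int[P]_x (a%:E + (\1_(~` A) x)%:E))%E.
  rewrite ge0_integralD//; try (by move=> x _; rewrite lee_fin).
  rewrite integral_cst//= (probability_setT P) mule1 integral_indic// ?setIT//;
    exact: measurableC.
apply: ae_ge0_le_integral => //;
  try (by move=> x _; rewrite lee_fin ?addr_ge0); try exact: trunc_measurable.
  exact: emeasurable_funD.
apply: filterS hA => x hA _; rewrite -EFinD lee_fin indicE in_setC.
case: (boolP (x \in A)) => /= [/set_mem/hA ha|_].
  by rewrite addr0 ge_min ha.
by rewrite ge_min lerDr a0 orbT.
Qed.

Lemma L0size_cvg0 (h_ : nat -> T -> R) :
  (forall n, measurable_fun setT (h_ n)) ->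
  (\forall x \ae P, h_ n x @[n --> \oo] --> 0) ->
  L0size (h_ n) @[n --> \oo] --> 0%E.
Proof.
move=> mh h0.
have [] := @dominated_convergence _ _ _ P setT measurableT
  (fun n x => (Num.min `|h_ n x| 1)%:E) (cst 0%E) (cst 1%E).
- by move=> n; exact: trunc_measurable.
- exact: measurable_cst.
- apply: filterS h0 => x h0 _; apply: cvg_EFin.
    by apply: nearW => n.
  apply/cvgr0Pnorm_lt => e e0.
  move/cvgr0Pnorm_lt : h0 => /(_ e e0); apply: filterS => n /= hn.
  by rewrite (ger0_norm (trunc_ge0 _ _)) gt_min hn.
- by apply: finite_measure_integrable_cst.
- apply: aeW => x n _ /=; rewrite lee_fin (ger0_norm (trunc_ge0 _ _)).
  by rewrite ge_min lexx orbT.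
- by move=> _ _; rewrite integral0.
Qed.

(** By Chebyshev, the set where [|h_ n|] reaches [2^-(n+1)] has measure at most
    [2^(n+1) 4^-(n+1) = 2^-(n+1)], which is summable; [G] is the complement of the limsup of these
    sets. *)
Lemma L0size_borel_cantelli (h_ : nat -> T -> R) :
  (forall n, measurable_fun setT (h_ n)) ->
  (forall n, (L0size (h_ n) <= ((4^-1) ^+ n.+1)%:E)%E) ->
  exists G : set T, [/\ measurable G, P (~` G) = 0%E &
    forall x, G x ->
      exists N, forall n, (N <= n)%N -> `|h_ n x| < 2^-1 ^+ n.+1].
Proof.
move=> mh hs; pose F n := [set x | 2^-1 ^+ n.+1 <= `|h_ n x|].
have mF n : measurable (F n) by exact: le_norm_measurable.
have mL : measurable (lim_sup_set F).
  by apply: bigcapT_measurable => n; apply: bigcup_measurable => k _; exact: mF.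
have half01 n : 0 < (2^-1 : R) ^+ n <= 1.
  by rewrite exprn_gt0 ?invr_gt0//= exprn_ile1 ?invr_ge0// invf_le1// ler1n.
exists (~` lim_sup_set F); split; first exact: measurableC.
  rewrite setCK; apply: lim_sup_set_cvg0 => //.
  have cv := @cvg_geometric_eseries_half R 1 0.
  apply: (@le_lt_trans _ _ (\sum_(n <oo) (1 / (2 ^ (n + 1))%:R)%:E)%E).
    apply: lee_nneseries => // n _.
    apply: (le_trans (L0size_chebyshev (mh n) (half01 n.+1))).
    rewrite lee_pdivrMl; last by case/andP: (half01 n.+1).
    apply: le_trans (hs n) _.
    rewrite -EFinM lee_fin addn1 div1r natrX -exprVn -exprMn.
    by rewrite -invfM -natrM.
  by move/cvg_lim : cv => ->//; rewrite ltry.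
move=> x hx.
have [N hN] : exists N, ~ (\bigcup_(j >= N) F j) x.
  by apply/existsNP => h; apply: hx => n _; exact: h.
exists N => n Nn; rewrite ltNge; apply/negP => hn.
by apply: hN; exists n.
Qed.

End size_in_measure.

(** * Normed modules over L0 *)

Section almost_everywhere_L0.
Context d (T : measurableType d) (R : realType).
Implicit Types mu nu : {measure set T -> \bar R}.

Lemma ae_null_dominates mu nu (Q : T -> Prop) : nu `<< mu ->
  (\forall x \ae mu, Q x) -> \forall x \ae nu, Q x.
Proof.
move=> /null_content_dominatesP numu [A [mA A0 QA]].
by exists A; split => //; exact: numu.
Qed.

Variable mu : {measure set T -> \bar R}.
Implicit Types f g : L0 mu.

Lemma L0_measurable f : measurable_fun setT f.
Proof. exact: measurable_funP. Qed.

Lemma L0_eqP f g : f = g <-> \forall x \ae mu, f x = g x.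
Proof.
split=> [->|fg]; first exact: aeW.
by rewrite -[f]reprK -[g]reprK; apply/L0_piP; apply: filterS fg.
Qed.

Lemma L0_cstE a : \forall x \ae mu, L0_cst mu a x = a.
Proof. by apply: filterS (L0_reprP mu (cst a)) => x; exact. Qed.

Lemma L0_zeroE : \forall x \ae mu, (0 : L0 mu) x = 0.
Proof. by rewrite -L0_pi0; apply: filterS (L0_reprP mu 0) => x; exact. Qed.

Lemma L0_oneE : \forall x \ae mu, (1 : L0 mu) x = 1.
Proof. by rewrite -L0_pi1; apply: filterS (L0_reprP mu 1) => x; exact. Qed.

Lemma L0_addE f g : \forall x \ae mu, (f + g : L0 mu) x = f x + g x.
Proof.
have e : f + g = \pi_(L0 mu) (repr f + repr g) by rewrite L0_piD !reprK.
have := L0_reprP mu (repr f + repr g); rewrite -e.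
by apply: filterS => x -> //; rewrite mfunD.
Qed.

Lemma L0_oppE f : \forall x \ae mu, (- f : L0 mu) x = - f x.
Proof.
have e : - f = \pi_(L0 mu) (- repr f) by rewrite L0_piN reprK.
have := L0_reprP mu (- repr f); rewrite -e.
by apply: filterS => x -> //; rewrite mfunN.
Qed.

End almost_everywhere_L0.

Section normed_module_theory.
Context d (T : measurableType d) (R : realType).
Variables (mu : {measure set T -> \bar R}) (mu' : probability T R).
Hypothesis mumu' : equivalent_measures mu mu'.
Variables (M : lmodType (L0 mu)) (norm : M -> L0 mu).
Hypothesis normedM : normed_L0_module mu' norm.
Implicit Types u v w : M.

Lemma module_distE v w : module_dist mu' norm v w = L0size mu' (norm (v - w)).
Proof.
rewrite /module_dist /L0_dist.
transitivity (L0size mu' (fun x => norm (v - w) x - (0 : L0 mu) x)) => //.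
have m1 := L0_measurable (norm (v - w)).
apply: L0size_ae_eq => //.
  by apply: measurable_funB => //; exact: L0_measurable.
(* The chosen representative of the zero class vanishes only almost everywhere. *)
apply: (ae_null_dominates mumu'.2).
by apply: filterS (L0_zeroE mu) => x ->; rewrite subr0.
Qed.

Lemma module_normN v : \forall x \ae mu, norm (- v) x = norm v x.
Proof.
rewrite -scaleN1r.
apply: filterS3 (norm_scale normedM (-1) v) (L0_oppE 1) (L0_oneE mu) => x.
by move=> -> -> ->; rewrite normrN1 mul1r.
Qed.

Lemma module_norm0 : \forall x \ae mu, norm 0 x = 0.
Proof. by apply/(norm_eq0 normedM). Qed.

Lemma module_norm_distC v w :
  \forall x \ae mu, norm (v - w) x = norm (w - v) x.
Proof. by rewrite -opprB; exact: module_normN. Qed.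

Lemma module_norm_dist_triangle u v w :
  \forall x \ae mu, norm (u - w) x <= norm (u - v) x + norm (v - w) x.
Proof.
by have := norm_triangle normedM (u - v) (v - w); rewrite addrA subrK.
Qed.

Lemma module_norm_lipschitz v w :
  \forall x \ae mu, `|norm v x - norm w x| <= norm (v - w) x.
Proof.
have h1 := norm_triangle normedM (v - w) w.
have h2 := norm_triangle normedM (w - v) v.
rewrite subrK in h1; rewrite subrK in h2.
apply: filterS3 h1 h2 (module_norm_distC v w) => x h1 h2 h3.
by rewrite ler_norml; move: h1 h2; rewrite -h3; lra.
Qed.

Lemma module_distC v w : module_dist mu' norm v w = module_dist mu' norm w v.
Proof.
rewrite !module_distE; apply: L0size_ae_eq; try exact: L0_measurable.
exact: ae_null_dominates mumu'.2 (module_norm_distC _ _).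
Qed.

Lemma module_dist_triangle u v w : (module_dist mu' norm u w <=
  module_dist mu' norm u v + module_dist mu' norm v w)%E.
Proof.
rewrite !module_distE; apply: L0sizeD_le; try exact: L0_measurable.
apply: (ae_null_dominates mumu'.2).
apply: filterS (filterI (module_norm_dist_triangle u v w) (filterI
  (norm_ge0 normedM (u - w)) (filterI (norm_ge0 normedM (u - v))
  (norm_ge0 normedM (v - w))))) => x [h [h1 [h2 h3]]].
by rewrite !ger0_norm.
Qed.

(** Bounds the error of replacing the scalar [a] by a constant [q] and the vectors by
    approximations. The bound is pointwise, so a rational [q] can later be chosen separately at each
    point. *)
Lemma module_norm_affine (a : L0 mu) (q : R) v v' p p' :
  \forall x \ae mu, norm (a *: v + v' - (L0_cst mu q *: p + p')) x <=
    `|a x - q| * norm v x + `|q| * norm (v - p) x + norm (v' - p') x.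
Proof.
set Q := L0_cst mu q.
have -> : a *: v + v' - (Q *: p + p') =
    (a - Q) *: v + (Q *: (v - p) + (v' - p')).
  rewrite scalerBl scalerBr opprD !addrA subrK; congr (_ + _).
  by rewrite [in RHS]addrAC addrAC.
have e1 := norm_triangle normedM ((a - Q) *: v) (Q *: (v - p) + (v' - p')).
have e2 := norm_triangle normedM (Q *: (v - p)) (v' - p').
have e3 := norm_scale normedM (a - Q) v.
have e4 := norm_scale normedM Q (v - p).
apply: filterS (filterI (filterI e1 e2) (filterI (filterI e3 e4)
  (filterI (L0_addE a (- Q)) (filterI (L0_oppE Q) (L0_cstE mu q))))) => x.
move=> [[h1 h2] [[h3 h4] [h5 [h6 h7]]]].
apply: le_trans h1 _; rewrite h3 h5 h6 h7 -addrA lerD2l.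
by apply: le_trans h2 _; rewrite h4 h7.
Qed.

End normed_module_theory.

(** * Uniqueness of pullbacks *)

Section pullback_comparison.
Context dX dY (X : measurableType dX) (Y : measurableType dY) (R : realType).
Variables (muX : {measure set X -> \bar R}) (muY : {measure set Y -> \bar R}).
Variables (muX' : probability X R) (muY' : probability Y R).
Hypothesis muXX' : equivalent_measures muX muX'.
Variable phi : {mfun X >-> Y}.
Variables (M : lmodType (L0 muY)) (normM : M -> L0 muY).

(* Locally, on a countable partition of [X], a pair of related elements is
   approximated by pullbacks of the same elements of [M]. This relation is the
   graph of the isomorphism between the two pullbacks. *)
Definition pullback_related (N1 N2 : lmodType (L0 muX)) (norm1 : N1 -> L0 muX)
    (norm2 : N2 -> L0 muX) (pb1 : M -> N1) (pb2 : M -> N2) n g :=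
  exists w : nat -> M, \forall x \ae muX, forall e : R, 0 < e ->
    exists j, norm1 (n - pb1 (w j)) x < e /\ norm2 (g - pb2 (w j)) x < e.

Lemma pullback_relatedC (N1 N2 : lmodType (L0 muX)) (norm1 : N1 -> L0 muX)
    (norm2 : N2 -> L0 muX) (pb1 : M -> N1) (pb2 : M -> N2) n g :
  pullback_related norm1 norm2 pb1 pb2 n g ->
  pullback_related norm2 norm1 pb2 pb1 g n.
Proof.
move=> [w nw]; exists w; apply: filterS nw => x nw e /nw[j []].
by exists j.
Qed.

Section two_pullbacks.
Variables (N1 N2 : lmodType (L0 muX)).
Variables (norm1 : N1 -> L0 muX) (norm2 : N2 -> L0 muX).
Variables (pb1 : M -> N1) (pb2 : M -> N2).
Hypothesis P1 : is_pullback muX' muY' phi normM norm1 pb1.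
Hypothesis P2 : is_pullback muX' muY' phi normM norm2 pb2.

Let nN1 := pullback_target P1.
Let nN2 := pullback_target P2.
Local Notation related := (pullback_related norm1 norm2 pb1 pb2).

Lemma pullback_related_pb v : related (pb1 v) (pb2 v).
Proof.
exists (fun=> v).
apply: filterS2 (module_norm0 nN1) (module_norm0 nN2) => x h1 h2 e e0.
by exists 0%N; rewrite !subrr h1 h2.
Qed.

(** At a fixed point [a x] is one real number, so a rational [q] near it and separate indices [i],
    [j] for the two pairs give a good approximation. The sequence [W] enumerates all these
    combinations and is the same for both modules. *)
Lemma pullback_relatedP (a : L0 muX) n n' g g' :
  related n g -> related n' g' -> related (a *: n + n') (a *: g + g').
Proof.
move=> [w nw] [w' nw'].
pose comb (k : nat) : rat * nat * nat := odflt (0 : rat, 0%N, 0%N) (unpickle k).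
pose W k := L0_cst muY (ratr (comb k).1.1) *: w (comb k).1.2 + w' (comb k).2.
exists W.
have b1 : \forall x \ae muX, forall k,
    norm1 (a *: n + n' - pb1 (W k)) x <=
    `|a x - ratr (comb k).1.1| * norm1 n x +
    `|ratr (comb k).1.1| * norm1 (n - pb1 (w (comb k).1.2)) x +
    norm1 (n' - pb1 (w' (comb k).2)) x.
  apply: ae_foralln => k; rewrite (pullback_linear P1).
  exact: (module_norm_affine nN1).
have b2 : \forall x \ae muX, forall k,
    norm2 (a *: g + g' - pb2 (W k)) x <=
    `|a x - ratr (comb k).1.1| * norm2 g x +
    `|ratr (comb k).1.1| * norm2 (g - pb2 (w (comb k).1.2)) x +
    norm2 (g' - pb2 (w' (comb k).2)) x.
  apply: ae_foralln => k; rewrite (pullback_linear P2).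
  exact: (module_norm_affine nN2).
apply: filterS (filterI (filterI nw nw') (filterI (filterI b1 b2)
  (filterI (norm_ge0 nN1 n) (norm_ge0 nN2 g)))).
move=> x [[{}nw {}nw'] [[{}b1 {}b2] [n0 g0]]] e e0.
have e3 : 0 < e / 3 by rewrite divr_gt0.
(* [S] bounds both norms and [K] will bound [|q|], so that each of the three error terms is at most
   a third of [e]. The added ones make the divisors positive. *)
pose S := norm1 n x + norm2 g x + 1.
have S0 : 0 < S by rewrite /S ltr_wpDl ?addr_ge0.
pose K := `|a x| + 1 + 1.
have K0 : 0 < K by rewrite /K !ltr_wpDl// addr_ge0.
have d0 : 0 < Num.min 1 (e / 3 / S) by rewrite lt_min ltr01 divr_gt0.
have [q aq] : exists q : rat, `|a x - ratr q| < Num.min 1 (e / 3 / S).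
  have [y [ay [q _ qy]]] : ball (a x) (Num.min 1 (e / 3 / S)) `&`
      range (ratr : rat -> R) !=set0.
    apply: dense_rat; last exact: ball_open.
    by exists (a x); exact: ballxx.
  by exists q; rewrite qy.
have [i [i1 i2]] := nw (e / 3 / K) (divr_gt0 e3 K0).
have [j [j1 j2]] := nw' _ e3.
have qK : `|ratr q| <= K.
  have : `|ratr q| <= `|a x| + `|a x - ratr q| :> R.
    rewrite -[X in `|X|](subrK (a x)) addrC (le_trans (ler_normD _ _))//.
    by rewrite distrC.
  by move: aq; rewrite lt_min /K; lra.
exists (pickle (q, i, j)).
have cE : comb (pickle (q, i, j)) = (q, i, j) by rewrite /comb pickleK.
have bound (t u v : R) : 0 <= t <= S -> u < e / 3 / K -> v < e / 3 ->
    `|a x - ratr q| * t + `|ratr q| * u + v < e.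
  move=> /andP[t0 tS] uK ve.
  have h1 : `|a x - ratr q| * t <= e / 3.
    apply: (@le_trans _ _ (e / 3 / S * S)); last by rewrite divfK// gt_eqF.
    by apply: ler_pM => //; move: aq; rewrite lt_min => /andP[_ /ltW].
  have h2 : `|ratr q| * u <= e / 3.
    have [u0|u0] := leP 0 u.
      apply: (@le_trans _ _ (K * (e / 3 / K))).
        by apply: ler_pM => //; exact: ltW.
      by rewrite mulrC divfK// gt_eqF.
    apply: (@le_trans _ _ 0); last exact: ltW.
    by rewrite mulr_ge0_le0// ltW.
  lra.
split.
- apply: le_lt_trans (b1 _) _; rewrite cE/=; apply: bound => //.
  by rewrite n0/= /S -addrA lerDl addr_ge0.
- apply: le_lt_trans (b2 _) _; rewrite cE/=; apply: bound => //.
  by rewrite g0/= /S -addrA addrCA lerDl addr_ge0.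
Qed.

(** Pullbacks of the same element have equal norms, and pointwise norms are 1-Lipschitz, so at
    almost every point the two values differ by less than any [e]. *)
Lemma pullback_related_norm n g : related n g -> norm1 n = norm2 g.
Proof.
move=> [w nw]; apply/L0_eqP.
have h1 : \forall x \ae muX, forall j, norm1 (pb1 (w j)) x = norm2 (pb2 (w j)) x.
  apply: ae_foralln => j.
  by apply: filterS2 (pullback_norm P1 (w j)) (pullback_norm P2 (w j)) => x -> ->.
have l1 : \forall x \ae muX, forall j,
    `|norm1 n x - norm1 (pb1 (w j)) x| <= norm1 (n - pb1 (w j)) x.
  by apply: ae_foralln => j; exact: (module_norm_lipschitz nN1).
have l2 : \forall x \ae muX, forall j,
    `|norm2 g x - norm2 (pb2 (w j)) x| <= norm2 (g - pb2 (w j)) x.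
  by apply: ae_foralln => j; exact: (module_norm_lipschitz nN2).
apply: filterS (filterI nw (filterI h1 (filterI l1 l2))).
move=> x [{}nw [{}h1 [{}l1 {}l2]]]; apply/eqP; rewrite -subr_eq0 -normr_le0.
apply/ler_addgt0Pr => e e0; rewrite add0r.
have [j [j1 j2]] := nw (e / 2) (divr_gt0 e0 (ltr0Sn _ 1)).
have := le_lt_trans (l1 j) j1; have := le_lt_trans (l2 j) j2.
rewrite h1 ler_norml !ltr_norml; lra.
Qed.

(** Smallness in measure yields, at almost every point, some [k] with both distances small; an
    approximation of the pair [n_ k], [g_ k] at that point then suffices by the triangle
    inequality. *)
Lemma pullback_related_lim n g (n_ : nat -> N1) (g_ : nat -> N2) :
  (forall k, related (n_ k) (g_ k)) ->
  (forall e : R, 0 < e -> exists k, (module_dist muX' norm1 n (n_ k) < e%:E)%E /\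
     (module_dist muX' norm2 g (g_ k) < e%:E)%E) ->
  related n g.
Proof.
move=> /choice[w nw] ng.
(* Adding the two distances lets one index [k] serve both modules. *)
pose h k x := norm1 (n - n_ k) x + norm2 (g - g_ k) x.
have mh k : measurable_fun setT (h k).
  by apply: measurable_funD; exact: L0_measurable.
have hinf : \forall x \ae muX, forall e : R, 0 < e -> exists k, `|h k x| < e.
  apply: (ae_null_dominates muXX'.1); apply: L0size_inf => // e e0.
  have e2 : 0 < e / 2 by rewrite divr_gt0.
  have [k [k1 k2]] := ng _ e2; exists k.
  rewrite [e]splitr EFinD; apply: le_lt_trans (lteD k1 k2).
  rewrite !(module_distE muXX'); apply: L0sizeD_le => //; try exact: L0_measurable.
  by apply: aeW => x; exact: ler_normD.
exists (fun m => let k := odflt (0%N, 0%N) (unpickle m) in w k.1 k.2).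
have t1 : \forall x \ae muX, forall k j, norm1 (n - pb1 (w k j)) x <=
    norm1 (n - n_ k) x + norm1 (n_ k - pb1 (w k j)) x.
  by apply: ae_foralln => k; apply: ae_foralln => j;
     exact: (module_norm_dist_triangle nN1).
have t2 : \forall x \ae muX, forall k j, norm2 (g - pb2 (w k j)) x <=
    norm2 (g - g_ k) x + norm2 (g_ k - pb2 (w k j)) x.
  by apply: ae_foralln => k; apply: ae_foralln => j;
     exact: (module_norm_dist_triangle nN2).
have p1 : \forall x \ae muX, forall k, 0 <= norm1 (n - n_ k) x.
  by apply: ae_foralln => k; exact: (norm_ge0 nN1).
have p2 : \forall x \ae muX, forall k, 0 <= norm2 (g - g_ k) x.
  by apply: ae_foralln => k; exact: (norm_ge0 nN2).
have {}nw := ae_foralln nw.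
apply: filterS (filterI (filterI hinf nw) (filterI (filterI t1 t2)
  (filterI p1 p2))) => x [[{}hinf {}nw] [[{}t1 {}t2] [{}p1 {}p2]]] e e0.
have e2 : 0 < e / 2 by rewrite divr_gt0.
have [k hk] := hinf _ e2; have [j [j1 j2]] := nw k _ e2.
exists (pickle (k, j)); rewrite pickleK /=.
move: hk; rewrite /h ger0_norm ?addr_ge0// => hk.
have := t1 k j; have := t2 k j; have := p1 k; have := p2 k; split; lra.
Qed.

(** By linearity, every element of the submodule spanned by the image of [pb1] has a partner. A
    general [n] is a limit of such elements [n_ k]; their partners have the same mutual distances,
    hence converge in the complete module [N2], and the limit is a partner of [n] by closedness. *)
Lemma pullback_related_total n : exists g, related n g.
Proof.
have span v : smallest (@is_submodule _ N1) (range pb1) v ->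
    exists g, related v g.
  move=> sv; apply: (sv [set u | exists g, related u g]); split; last first.
    by move=> _ [v' _ <-]; exists (pb2 v'); exact: pullback_related_pb.
  split.
    (* The witness equals zero; the pair of zeros comes from subtracting the pair [pb1 0], [pb2 0]
       from itself. *)
    exists (0 - pb2 0 + pb2 0).
    have := pullback_relatedP (-1) (pullback_related_pb 0) (pullback_related_pb 0).
    by rewrite !scaleN1r sub0r !addNr.
  by move=> a u v' [g ug] [g' vg']; exists (a *: g + g'); exact: pullback_relatedP.
have eps k : 0 < k.+1%:R^-1 :> R by rewrite invr_gt0.
have /choice[n_ nn] k : exists n', (exists g, related n' g) /\
    (module_dist muX' norm1 n n' < (k.+1%:R^-1)%:E)%E.
  have [n' sn' nn'] := pullback_generates P1 n (eps k).
  by exists n'; split => //; exact: span.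
have /choice[g_ ng] k : exists g, related (n_ k) g by case: (nn k).
have dist_g i j : module_dist muX' norm2 (g_ i) (g_ j) =
    module_dist muX' norm1 (n_ i) (n_ j).
  rewrite (module_distE muXX') (module_distE muXX'); congr (L0size _ (L0_fun _)).
  apply/esym/pullback_related_norm.
  have := pullback_relatedP (-1) (ng j) (ng i).
  by rewrite !scaleN1r ![- _ + _]addrC.
have [|g g_cvg] := norm_complete nN2 (u := g_).
  move=> e e0; have e2 : 0 < e / 2 by rewrite divr_gt0.
  have [N _ hN] := near_infty_natSinv_lt (PosNum e2).
  exists N => i j Ni Nj; rewrite dist_g.
  apply: le_lt_trans (module_dist_triangle muXX' nN1 (n_ i) n (n_ j)) _.
  rewrite [e]splitr EFinD; apply: lteD.
    rewrite (module_distC muXX' nN1); apply: lt_trans (nn i).2 _.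
    by rewrite lte_fin; exact: hN.
  by apply: lt_trans (nn j).2 _; rewrite lte_fin; exact: hN.
exists g; apply: (pullback_related_lim ng) => e e0.
have [N1' _ h1] := near_infty_natSinv_lt (PosNum e0).
have [N2' _ h2] : \forall k \near \oo, (module_dist muX' norm2 (g_ k) g < e%:E)%E.
  apply: (g_cvg [set r | (r < e%:E)%E]); apply: open_nbhs_nbhs.
  by split; [exact: open_ereal_lt_ereal|rewrite /= lte_fin].
exists (maxn N1' N2'); split.
  apply: lt_trans (nn _).2 _; rewrite lte_fin; apply: h1; exact: leq_maxl.
rewrite (module_distC muXX' nN2); apply: h2; exact: leq_maxr.
Qed.

(** The difference of the two partners is related to zero, hence has norm zero. *)
Lemma pullback_related_inj n g g' : related n g -> related n g' -> g = g'.
Proof.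
move=> ng ng'; apply/eqP; rewrite -subr_eq0; apply/eqP/(norm_eq0 nN2).
have := pullback_relatedP (-1) ng' ng.
rewrite !scaleN1r addNr addrC => /pullback_related_norm <-.
exact: module_norm0 nN1.
Qed.

End two_pullbacks.

(** Totality in both directions gives maps [F] and [G]; single-valuedness makes [F] linear and the
    two mutually inverse. *)
Theorem pullback_unique (N1 N2 : lmodType (L0 muX))
    (norm1 : N1 -> L0 muX) (norm2 : N2 -> L0 muX)
    (pb1 : M -> N1) (pb2 : M -> N2) :
  is_pullback muX' muY' phi normM norm1 pb1 ->
  is_pullback muX' muY' phi normM norm2 pb2 ->
  exists Phi : {linear N1 -> N2},
    module_isomorphism norm1 norm2 Phi /\ forall v, Phi (pb1 v) = pb2 v.
Proof.
move=> P1 P2.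
have /choice[F nF] := pullback_related_total P1 P2.
have /choice[G gG] := pullback_related_total P2 P1.
have linF : linear F.
  move=> a u v; apply: (pullback_related_inj P1 P2 (nF _)).
  exact: (pullback_relatedP P1 P2).
pose Phi : {linear N1 -> N2} := HB.pack F (GRing.isLinear.Build _ _ _ _ F linF).
exists Phi; split; first split.
- exists G => [n|g].
    exact: (pullback_related_inj P2 P1 (gG _) (pullback_relatedC (nF n))).
  exact: (pullback_related_inj P1 P2 (nF _) (pullback_relatedC (gG g))).
- by move=> n; rewrite -(pullback_related_norm P1 P2 (nF n)).
- move=> v; apply: (pullback_related_inj P1 P2 (nF _)).
  exact: pullback_related_pb P1 P2 v.
Qed.

End pullback_comparison.

(** * Measurable selection in bundles *)

Lemma separable_seq (S : ptopologicalType) : separable S ->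
  exists u : nat -> S, forall O : set S, open O -> O !=set0 ->
    exists k, O (u k).
Proof.
move=> [D cD dD].
have /countable_injP[f finj] := cD.
exists (fun k => xget point [set a | D a /\ f a = k]) => O oO O0.
have [a [Oa Da]] := dD O O0 oO; exists (f a).
case: xgetP => [b _ [Db fba]|/(_ a)]; last by case.
by rewrite (finj b a) // inE.
Qed.

(** Making the cover disjoint gives each point one index; the glued map takes countably many values,
    so every preimage is a countable union of measurable pieces. *)
Lemma countable_glue d (T : measurableType d) (W : ptopologicalType)
    (C : nat -> set T) (u : nat -> W) :
  (forall k, measurable (C k)) -> (forall x, exists k, C k x) ->
  exists2 g : T -> W, forall O, open O -> measurable (g @^-1` O) &
    forall x, exists2 k, C k x & g x = u k.
Proof.
move=> mC cC.
have /choice[k_ kC] x : exists k, seqDU C k x.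
  have : (\bigcup_k C k) x by have [k Ck] := cC x; exists k.
  by rewrite seqDU_bigcup_eq => -[k _ Ck]; exists k.
exists (u \o k_) => [U _|x]; last by exists (k_ x) => //; have [] := kC x.
have -> : (u \o k_) @^-1` U =
      \bigcup_(k in [set k | U (u k)]) seqDU C k.
  apply/seteqP; split=> [x /= Ox|x [k /= Ok Ck]]; first by exists (k_ x).
  suff <- : k = k_ x by [].
  by apply: (trivIset_seqDU C) => //; exists x.
by apply: bigcup_measurable => k _; exact: seqDU_measurable.
Qed.

(** [f x] lies in [O] exactly when, for some [m], the points [f_ n x] eventually lie in [U m], the
    interior of the set of centres whose ball of radius [1/(m+1)] is inside [O]. *)
Lemma measurable_cvg_open d (T : measurableType d) (R : realType)
    (W : pseudoPMetricType R) (f_ : nat -> T -> W) (f : T -> W) :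
  (forall n O, open O -> measurable (f_ n @^-1` O)) ->
  (forall x, f_ n x @[n --> \oo] --> f x) ->
  forall O, open O -> measurable (f @^-1` O).
Proof.
move=> mf_ cf O oO.
pose U m := [set z | ball z (m.+1%:R^-1 : R) `<=` O]^°.
have -> : f @^-1` O = \bigcup_m \bigcup_N \bigcap_(n in [set n | (N <= n)%N])
    (f_ n @^-1` U m).
  apply/seteqP; split=> [x /= Ox|x [m _ [N _ UN]] /=]; last first.
    have [N' _ hN'] : \forall n \near \oo, ball (f x) (m.+1%:R^-1 : R) (f_ n x).
      by move/cvg_ballP : (cf x); apply; rewrite invr_gt0.
    have := UN (maxn N N') (leq_maxl _ _) => /interior_subset /=; apply.
    by apply: ball_sym; apply: hN'; exact: leq_maxr.
  have : nbhs (f x) O by exact: open_nbhs_nbhs.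
  move=> /nbhs_ballP[r /= r0 rO].
  have r2 : 0 < r / 2 by rewrite divr_gt0.
  have [m _ /(_ m (leqnn m)) mr] := near_infty_natSinv_lt (PosNum r2).
  have Uf : U m (f x).
    apply/nbhs_ballP; exists (r / 2) => //= z fz t zt; apply: rO.
    rewrite [r]splitr; apply: ball_triangle fz _.
    by apply: le_ball zt; exact: ltW.
  have [N _ hN] : \forall n \near \oo, U m (f_ n x).
    by apply: (cf x); apply: open_nbhs_nbhs; split => //; exact: open_interior.
  by exists m => //; exists N => // n /= Nn; exact: hN.
apply: bigcup_measurable => m _; apply: bigcup_measurable => N _.
apply: bigcap_measurableType => n _; apply: mf_; exact: open_interior.
Qed.

Lemma geometric_cauchy (R : realType) (V : completeNormedModType R)
    (u : nat -> V) (c : R) N :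
  (forall n, (N <= n)%N -> `|u n - u n.+1| <= c * 2^-1 ^+ n) ->
  exists2 l, u n @[n --> \oo] --> l &
    forall n, (N <= n)%N -> `|u n - l| <= 2 * c * 2^-1 ^+ n.
Proof.
move=> cu.
(* Keeping the subtracted tail on the right lets the induction on [k] close. *)
have h n k : (N <= n)%N ->
    `|u n - u (n + k)%N| <= 2 * c * 2^-1 ^+ n - 2 * c * 2^-1 ^+ (n + k).
  move=> Nn; elim: k => [|k ih]; first by rewrite addn0 !subrr normr0.
  rewrite addnS -(subrK (u (n + k)%N) (u n)) -addrA.
  apply: le_trans (ler_normD _ _) _.
  have := cu (n + k)%N (leq_trans Nn (leq_addr _ _)).
  rewrite exprS; lra.
have c0 : 0 <= c.
  have := le_trans (normr_ge0 _) (cu N (leqnn N)).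
  by rewrite pmulr_lge0// exprn_gt0// invr_gt0.
have h' n m : (N <= n <= m)%N -> `|u n - u m| <= 2 * c * 2^-1 ^+ n.
  move=> /andP[Nn nm]; have := h n (m - n)%N Nn; rewrite subnKC// => hnm.
  have : 0 <= 2 * c * 2^-1 ^+ m by rewrite !mulr_ge0 ?exprn_ge0 ?invr_ge0.
  by move: hnm; lra.
have z0 : 2 * c * 2^-1 ^+ n @[n --> \oo] --> (0 : R).
  by apply: cvg_geometric; rewrite ger0_norm ?invr_ge0// invf_lt1// ltr1n.
have cvu : cvg (u n @[n --> \oo]).
  apply: cauchy_cvg; apply: cauchy_exP => e e0.
  have [N' _ hN'] := cvgr0_norm_lt _ z0 _ e0.
  exists (u (maxn N N')); exists (maxn N N') => // m /= Nm.
  rewrite -ball_normE /=.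
  apply: le_lt_trans (h' _ m _) _; first by rewrite leq_maxl.
  by apply: le_lt_trans (ler_norm _) _; apply: hN'; exact: leq_maxr.
exists (lim (u n @[n --> \oo])) => // n Nn.
have cn : `|u n - u m| @[m --> \oo] --> `|u n - lim (u n @[n --> \oo])|.
  by apply: cvg_norm; apply: cvgB => //; exact: cvg_cst.
rewrite -(cvg_lim _ cn)//; apply: limr_le;
  first by apply/cvg_ex; eexists; exact: cn.
by exists n => // m /= nm; apply: h'; rewrite Nn.
Qed.

Section bundle_selection.
Context (R : realType) (B : separableBanachType R).
Context d (Y : measurableType d) (E : banach_bundle B Y).

Let near_fiber (f : Y -> B) (r : R) :=
  forall y, exists2 z, (E y : set B) z & `|f y - z| < r.

Let measurable_to_B (f : Y -> B) :=
  forall O : set B, open O -> measurable (f @^-1` O).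

(** The value [u k] of a dense sequence is allowed at [y] if it is within [2 * r] of [f y] and
    within [r / 2] of the fibre, the latter being measurable by the definition of a bundle. A dense
    vector within [r / 2] of a fibre point near [f y] meets both conditions, as
    [r + r / 2 < 2 * r]. *)
Let refine (f : Y -> B) (r : R) : measurable_to_B f -> 0 < r -> near_fiber f r ->
  exists g, [/\ measurable_to_B g, near_fiber g (r / 2) &
    forall y, `|f y - g y| < 2 * r].
Proof.
move=> mf r0 fr; have r2 : 0 < r / 2 by rewrite divr_gt0.
have [u du] := separable_seq (@separableT _ B).
pose C k := f @^-1` (ball (u k) (2 * r)) `&`
            [set y | (E y : set B) `&` ball (u k) (r / 2) !=set0].
have [] := @countable_glue _ Y B C u.
- move=> k; apply: measurableI; first by apply: mf; exact: ball_open.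
  by apply: fiber_measurable; exact: ball_open.
- move=> y; have [z Ez fz] := fr y.
  have [k zk] := du (ball z (r / 2)) (ball_open _ _) (ex_intro _ z (ballxx z r2)).
  exists k; split; last by exists z; split => //; exact: ball_sym.
  rewrite /= -ball_normE /= distrC.
  move: zk; rewrite -ball_normE /= => zk.
  by have := ler_distD z (f y) (u k); lra.
- move=> g mg gC; exists g; split => // y; have [k [fk [z [Ez zk]]] ->] := gC y.
    by exists z => //; move: zk; rewrite -ball_normE.
  by move: fk; rewrite /= -ball_normE /= distrC.
Qed.

(* Kuratowski--Ryll-Nardzewski selection: a measurable map at distance less than
   [r] from the fibres is successively corrected by countably valued maps at
   distance less than [r / 2 ^ n] from the fibres. *)
Lemma near_fiber_section (f : Y -> B) (r : R) :
  (forall O : set B, open O -> measurable (f @^-1` O)) -> 0 < r ->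
  (forall y, exists2 z, (E y : set B) z & `|f y - z| < r) ->
  exists s : bundle_section E, forall y, `|f y - s y| <= 4 * r.
Proof.
move=> mf r0 fr.
have half0 n : 0 < (2^-1 : R) ^+ n by rewrite exprn_gt0// invr_gt0.
pose good n g := measurable_to_B g /\ near_fiber g (r * 2^-1 ^+ n).
have step n (g : {g | good n g}) : {g' : {g' | good n.+1 g'} |
    forall y, `|sval g y - sval g' y| < 2 * (r * 2^-1 ^+ n)}.
  case: g => g [mg gr] /=; apply: cid.
  have [g' [mg' gr' gg']] := refine mg (mulr_gt0 r0 (half0 n)) gr.
  have gg : good n.+1 g' by split => //; rewrite exprSr mulrA.
  by exists (exist _ g' gg).
have good0 : good 0 f by split => //; rewrite expr0 mulr1.
pose F := fix F n : {g | good n g} :=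
  if n is n'.+1 then sval (step n' (F n')) else exist _ f good0.
have FS n y : `|sval (F n) y - sval (F n.+1) y| <= 2 * r * 2^-1 ^+ n.
  by rewrite -mulrA ltW//; exact: (svalP (step n (F n)) y).
have /choice[s0 hs0] y : exists l, sval (F n) y @[n --> \oo] --> l /\
    forall n, `|sval (F n) y - l| <= 2 * (2 * r) * 2^-1 ^+ n.
  have [l l1 l2] := geometric_cauchy (N := 0) (fun n _ => FS n y).
  by exists l; split => // n; exact: l2.
have ms0 : measurable_to_B s0.
  apply: (measurable_cvg_open (f_ := fun n => sval (F n))) => [n|y].
    by case: (svalP (F n)).
  by case: (hs0 y).
have s0E y : (E y : set B) (s0 y).
  have /choice[z hz] n : exists z, (E y : set B) z /\
      `|sval (F n) y - z| < r * 2^-1 ^+ n.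
    by have [_ /(_ y)[z Ez Fz]] := svalP (F n); exists z.
  (* The limit is also that of fibre points [z n] within [r / 2 ^ n] of the approximations, and the
     fibre is closed. *)
  apply: (closed_cvg _ (@gr_closed _ _ (E y)) (_ : \forall n \near \oo, _ (z n))).
    by apply: nearW => n; case: (hz n).
  have /cvgrPdist_lt Fs := (hs0 y).1.
  have z0 : r * 2^-1 ^+ n @[n --> \oo] --> (0 : R).
    by apply: cvg_geometric; rewrite ger0_norm ?invr_ge0// invf_lt1// ltr1n.
  apply/cvgrPdist_lt => e e0; have e2 : 0 < e / 2 by rewrite divr_gt0.
  apply: filterS2 (Fs _ e2) (cvgr0_norm_lt _ z0 _ e2) => n h1 h2.
  have := ler_distD (sval (F n) y) (s0 y) (z n).
  by have := (hz n).2; have := le_lt_trans (ler_norm _) h2; lra.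
exists (@BundleSection _ _ _ _ E s0 ((measurable_borelP _).2 ms0) s0E) => y /=.
(* The corrections [2 * r / 2 ^ n] sum to [4 * r]. *)
by have := (hs0 y).2 0%N; rewrite expr0 mulr1 /=; lra.
Qed.

(** Selection is applied to the map equal to [b] where the fibre meets the ball of radius [r] around
    [b], and to 0 elsewhere; as every fibre contains 0, this map is near the fibres everywhere. With
    [b] in a dense sequence, the resulting sections come close to every fibre vector. *)
Lemma section_near_vector (b : B) (r : R) : 0 < r ->
  exists s : bundle_section E, forall y z, (E y : set B) z -> `|b - z| < r ->
    `|b - s y| <= 4 * r.
Proof.
move=> r0; pose A := [set y | (E y : set B) `&` ball b r !=set0].
have mA : measurable A by apply: fiber_measurable; exact: ball_open.
have [] := @countable_glue _ Y B (fun k => if k is 0%N then A else ~` A)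
  (fun k => if k is 0%N then b else 0).
- by case=> [|k] /=; [exact: mA|exact: measurableC].
- by move=> y; have [Ay|nAy] := pselect (A y); [exists 0%N|exists 1%N].
move=> f mf fA; have [|s hs] := near_fiber_section mf r0.
  move=> y; have [[|k] Ay ->] := fA y.
    by have [z [Ez bz]] := Ay; exists z => //; move: bz; rewrite -ball_normE.
  by exists 0; [case: (gr_submodule (E y))|rewrite subrr normr0].
exists s => y z Ez bz; have [[|k] Ay fE] := fA y; first by rewrite -fE.
by case: Ay; exists z; split => //; rewrite -ball_normE.
Qed.

End bundle_selection.

(** * The module of sections *)

Lemma nonneg_ereal_cvg0 (R : realType) (f : nat -> \bar R) :
  (forall n, (0 <= f n)%E) ->
  (forall e : R, 0 < e -> \forall n \near \oo, (f n < e%:E)%E) ->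
  f n @[n --> \oo] --> 0%E.
Proof.
move=> f0 fe; apply/fine_cvgP; split.
  apply: filterS (fe 1 ltr01) => n fn.
  by rewrite ge0_fin_numE//; apply: lt_trans fn _; rewrite ltry.
apply/cvgr0Pnorm_lt => e e0; apply: filterS (fe e e0) => n fn /=.
have fin : f n \is a fin_num.
  by rewrite ge0_fin_numE//; apply: lt_trans fn _; rewrite ltry.
by rewrite ger0_norm ?fine_ge0// -lte_fin fineK.
Qed.

Section section_module.
Context (R : realType) (B : separableBanachType R).
Context d (Y : measurableType d) (E : banach_bundle B Y).
Variables (mu : {measure set Y -> \bar R}) (mu' : probability Y R).
Hypothesis mumu' : equivalent_measures mu mu'.
Local Notation G := (Gamma E mu).
Local Notation norm := (@Gamma_norm _ _ _ _ E mu).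
Implicit Types s t : G.

Lemma section_dist_measurable (s t : bundle_section E) :
  measurable_fun setT (fun y => `|s y - t y|).
Proof.
rewrite (_ : (fun _ => _) = section_norm (sectionD s (sectionZ (-1) t))).
  exact: measurable_funP.
by apply/funext => y; rewrite /= /section_norm_fun /= scaleN1r.
Qed.

Lemma Gamma_eqP s t : s = t <-> \forall y \ae mu, Gamma_fun s y = Gamma_fun t y.
Proof.
split=> [->|st]; first exact: aeW.
by rewrite -[s]reprK -[t]reprK; apply/Gamma_piP; apply: filterS st.
Qed.

Lemma Gamma_normE s : \forall y \ae mu, norm s y = `|Gamma_fun s y|.
Proof. by apply: filterS (L0_reprP mu (section_norm (repr s))) => y; exact. Qed.

Lemma Gamma_funD s t :
  \forall y \ae mu, Gamma_fun (s + t) y = Gamma_fun s y + Gamma_fun t y.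
Proof.
have e : s + t = \pi_G (sectionD (repr s) (repr t)) by rewrite Gamma_piD !reprK.
have := Gamma_reprP mu (sectionD (repr s) (repr t)); rewrite -e.
by apply: filterS => y ->.
Qed.

Lemma Gamma_funZ (f : L0 mu) s :
  \forall y \ae mu, Gamma_fun (f *: s) y = f y *: Gamma_fun s y.
Proof.
by apply: filterS (Gamma_reprP mu (sectionZ (repr f) (repr s))) => y; exact.
Qed.

Lemma Gamma_funB s t :
  \forall y \ae mu, Gamma_fun (s - t) y = Gamma_fun s y - Gamma_fun t y.
Proof.
rewrite -scaleN1r.
apply: filterS (filterI (filterI (Gamma_funD s (-1 *: t)) (Gamma_funZ (-1) t))
  (filterI (L0_oppE (1 : L0 mu)) (L0_oneE mu))) => y [[-> ->] [-> ->]].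
by rewrite scaleN1r.
Qed.

Lemma Gamma_fun0 : \forall y \ae mu, Gamma_fun (0 : G) y = 0.
Proof.
by rewrite -Gamma_pi0; apply: filterS (Gamma_reprP mu (section0 E)) => y; exact.
Qed.

Lemma Gamma_distE s t : module_dist mu' norm s t =
  L0size mu' (fun y => `|Gamma_fun s y - Gamma_fun t y|).
Proof.
rewrite (module_distE mumu'); apply: L0size_ae_eq.
- exact: L0_measurable.
- exact: section_dist_measurable.
- apply: (ae_null_dominates mumu'.2).
  by apply: filterS2 (Gamma_normE (s - t)) (Gamma_funB s t) => y -> ->.
Qed.

Lemma Gamma_dist_triangle s t u : (module_dist mu' norm s u <=
  module_dist mu' norm s t + module_dist mu' norm t u)%E.
Proof.
rewrite !Gamma_distE; apply: L0sizeD_le; try exact: section_dist_measurable.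
by apply: aeW => y; rewrite !normr_id; exact: ler_distD.
Qed.

(* A rapidly Cauchy sequence of sections converges off a null set by
   Borel--Cantelli; the representatives are set to zero there so that the limit
   exists everywhere. *)
Lemma Gamma_fast_complete (v : nat -> G) :
  (forall n, (module_dist mu' norm (v n) (v n.+1) <= (4^-1 ^+ n.+1)%:E)%E) ->
  exists s, module_dist mu' norm (v n) s @[n --> \oo] --> 0%E.
Proof.
move=> v_fast.
have [|A [mA A0 hA]] := L0size_borel_cantelli
    (fun n => section_dist_measurable (repr (v n)) (repr (v n.+1)))
    (P := mu').
  by move=> n; rewrite -Gamma_distE.
pose iA : {mfun Y >-> R} := mindic R mA.
have iAE y : iA y = (y \in A)%:R by rewrite -indicE.
pose w n := sectionZ iA (repr (v n)).
have w_in n y : A y -> w n y = Gamma_fun (v n) y.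
  by move=> Ay; rewrite /w /= iAE mem_set// scale1r.
have w_out n y : ~ A y -> w n y = 0.
  by move=> Ay; rewrite /w /= iAE memNset// scale0r.
have /choice[s0 ws0] (y : Y) : exists l : B, w n y @[n --> \oo] --> l.
  have [Ay|nAy] := pselect (A y); last first.
    by exists 0; under eq_fun do rewrite w_out//; exact: cvg_cst.
  have [N hN] := hA _ Ay.
  have [|l] := @geometric_cauchy R B (w ^~ y) 2^-1 N.
    move=> n Nn; rewrite !w_in// -exprS ltW//.
    by have := hN n Nn; rewrite normr_id.
  by exists l.
have ms0 : measurable_fun setT (s0 : Y -> borel B).
  apply/measurable_borelP; apply: (measurable_cvg_open (f_ := w)) => // n.
  exact/measurable_borelP/section_measurable.
have s0E y : (E y : set B) (s0 y).
  apply: (closed_cvg _ (@gr_closed _ _ (E y)) _ _ (ws0 y)).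
  by apply: nearW => n; exact: section_fiber.
pose S := @BundleSection _ _ _ _ E s0 ms0 s0E.
exists (\pi_G S); under eq_fun do rewrite Gamma_distE.
apply: L0size_cvg0 => [n|]; first exact: section_dist_measurable.
have aeA : \forall y \ae mu', A y by exists (~` A); split => //; exact: measurableC.
apply: filterS2 aeA (ae_null_dominates mumu'.2 (Gamma_reprP mu S)) => y Ay -> //.
rewrite -(normr0 B) -(subrr (s0 y)); apply: cvg_norm.
apply: cvgB; last exact: cvg_cst.
by have := ws0 y; under eq_fun do rewrite w_in//.
Qed.

Lemma Gamma_normed : normed_L0_module mu' norm.
Proof.
split.
- by move=> s; apply: filterS (Gamma_normE s) => y ->.
- move=> s; rewrite Gamma_eqP; split=> h.
    apply: filterS (filterI h (filterI (Gamma_normE s) Gamma_fun0)).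
    by move=> y [h1 [h2 ->]]; apply/eqP; rewrite -normr_eq0 -h2 h1.
  apply: filterS (filterI h (filterI (Gamma_normE s) Gamma_fun0)).
  by move=> y [h1 [-> h2]]; rewrite h1 h2 normr0.
- move=> s t; apply: filterS (filterI (filterI (Gamma_normE (s + t))
    (Gamma_funD s t)) (filterI (Gamma_normE s) (Gamma_normE t))).
  by move=> y [[-> ->] [-> ->]]; exact: ler_normD.
- move=> f s; apply: filterS (filterI (Gamma_normE (f *: s))
    (filterI (Gamma_funZ f s) (Gamma_normE s))).
  by move=> y [-> [-> ->]]; rewrite normrZ.
- move=> u u_cauchy.
  have /choice[K hK] n : exists n0, forall i j, (n0 <= i)%N -> (n0 <= j)%N ->
      (module_dist mu' norm (u i) (u j) < ((4^-1) ^+ n.+1)%:E)%E.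
    by apply: u_cauchy; rewrite exprn_gt0// invr_gt0.
  (* Adding up the [K i] makes [k] nondecreasing and at least [K n]; the term [n] makes it tend to
     infinity. *)
  pose k n := (\sum_(i < n.+1) K i + n)%N.
  have kS n : (k n <= k n.+1)%N.
    by rewrite /k leq_add// [leqRHS]big_ord_recr leq_addr.
  have Kk n : (K n <= k n)%N.
    by rewrite /k big_ord_recr /= addnAC leq_addl.
  have nk n : (n <= k n)%N by exact: leq_addl.
  have [|s hs] := @Gamma_fast_complete (u \o k).
    by move=> n; apply/ltW/hK => //=; exact: leq_trans (Kk n) (kS n).
  exists s; apply: nonneg_ereal_cvg0 => [n|e e0].
    by rewrite Gamma_distE; exact: L0size_ge0.
  have e2 : 0 < e / 2 by rewrite divr_gt0.
  have [N hN] := u_cauchy _ e2.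
  have [N' _ hN'] : \forall n \near \oo,
      (module_dist mu' norm (u (k n)) s < (e / 2)%:E)%E.
    apply: (hs [set r | (r < (e / 2)%:E)%E]); apply: open_nbhs_nbhs.
    by split; [exact: open_ereal_lt_ereal|rewrite /= lte_fin].
  exists N => // i /= Ni.
  apply: le_lt_trans (Gamma_dist_triangle (u i) (u (k (maxn N N'))) s) _.
  rewrite [e]splitr EFinD; apply: lteD; last by apply: hN'; exact: leq_maxr.
  by apply: hN => //; apply: leq_trans (nk _); exact: leq_maxl.
Qed.

End section_module.

(** * The pullback of sections *)

Section section_pullback.
Context (R : realType) (B : separableBanachType R).
Context dX dY (X : measurableType dX) (Y : measurableType dY).
Variables (phi : {mfun X >-> Y}) (E : banach_bundle B Y).
Variables (muX : {measure set X -> \bar R}) (muY : {measure set Y -> \bar R}).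
Hypothesis phi_null :
  forall A, measurable A -> muY A = 0%E -> muX (phi @^-1` A) = 0%E.
Variables (muX' : probability X R) (muY' : probability Y R).
Hypothesis muXX' : equivalent_measures muX muX'.
Hypothesis muYY' : equivalent_measures muY muY'.
Local Notation phiE := (pullback_bundle phi E).
Local Notation normX := (@Gamma_norm _ _ _ _ phiE muX).
Local Notation normY := (@Gamma_norm _ _ _ _ E muY).

Lemma ae_preimage (Q : Y -> Prop) :
  (\forall y \ae muY, Q y) -> \forall x \ae muX, Q (phi x).
Proof.
move=> [A [mA A0 QA]]; exists (phi @^-1` A); split.
- by rewrite -[X in measurable X]setTI; exact: measurable_funP.
- exact: phi_null.
- by move=> x /= nQ; exact: QA.
Qed.

Definition section_comp (s : bundle_section E) : bundle_section phiE :=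
  @BundleSection _ _ _ _ phiE (s \o phi)
    (measurableT_comp (@section_measurable _ _ _ _ _ s) (measurable_funP phi))
    (fun x => section_fiber s (phi x)).

Definition Gamma_pullback (s : Gamma E muY) : Gamma phiE muX :=
  \pi_(Gamma phiE muX) (section_comp (repr s)).

(** Composition with [phi] respects almost-everywhere equality because preimages of null sets are
    null. *)
Lemma Gamma_pullback_pi s :
  Gamma_pullback (\pi_(Gamma E muY) s) = \pi_(Gamma phiE muX) (section_comp s).
Proof.
apply/Gamma_piP.
by apply: filterS (ae_preimage (Gamma_reprP muY s)) => x h _; exact: h.
Qed.

Lemma Gamma_pullbackE s :
  \forall x \ae muX, Gamma_fun (Gamma_pullback s) x = Gamma_fun s (phi x).
Proof.
by apply: filterS (Gamma_reprP muX (section_comp (repr s))) => x; exact.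
Qed.

Lemma Gamma_pullback_linear a s t :
  Gamma_pullback (L0_cst muY a *: s + t) =
  L0_cst muX a *: Gamma_pullback s + Gamma_pullback t.
Proof.
apply/Gamma_eqP.
apply: filterS (filterI (filterI (Gamma_pullbackE (L0_cst muY a *: s + t))
    (ae_preimage (filterI (Gamma_funD (L0_cst muY a *: s) t)
      (filterI (Gamma_funZ (L0_cst muY a) s) (L0_cstE muY a)))))
  (filterI (filterI (Gamma_funD (L0_cst muX a *: Gamma_pullback s)
      (Gamma_pullback t))
    (filterI (Gamma_funZ (L0_cst muX a) (Gamma_pullback s)) (L0_cstE muX a)))
    (filterI (Gamma_pullbackE s) (Gamma_pullbackE t)))).
by move=> x [[-> [-> [-> ->]]] [[-> [-> ->]] [-> ->]]].
Qed.

Lemma Gamma_pullback_norm s :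
  \forall x \ae muX, normX (Gamma_pullback s) x = normY s (phi x).
Proof.
apply: filterS (filterI (Gamma_normE (Gamma_pullback s))
  (filterI (Gamma_pullbackE s) (ae_preimage (Gamma_normE s)))).
by move=> x [-> [-> ->]].
Qed.

Lemma Gamma_pullback_generates : generates muX' normX (range Gamma_pullback).
Proof.
move=> v e e0; have e2 : 0 < e / 2 by rewrite divr_gt0.
(* A dense vector contributes [r] and its section [4 * r], so every fibre vector is within
   [5 * r = e / 2] of some section. *)
pose r := e / 2 / 5; have r0 : 0 < r by rewrite divr_gt0.
have [u du] := separable_seq (@separableT _ B).
have /choice[s hs] k := section_near_vector E (u k) r0.
pose t := repr v.
pose A k := [set x | `|t x - s k (phi x)| <= e / 2].
have mA k : measurable (A k).
  rewrite -[X in measurable X]setTI.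
  exact: measurable_fun_le (section_dist_measurable t (section_comp (s k)))
    (measurable_cst _).
have covA x : exists k, A k x.
  have [k uk] := du (ball (t x) r) (ball_open _ _)
    (ex_intro _ (t x) (ballxx (t x) r0)).
  move: uk; rewrite -ball_normE /= => uk.
  exists k; have := hs k (phi x) (t x) (section_fiber t x).
  rewrite distrC uk => /(_ isT) h; rewrite /A /=.
  by have := ler_distD (u k) (t x) (s k (phi x)); move: h uk; rewrite /r; lra.
pose F N := \big[setU/set0]_(k < N) A k.
have mF N : measurable (F N) by apply: bigsetU_measurable.
have [w hw] : exists w : nat -> bundle_section phiE, forall N,
    smallest (@is_submodule _ _) (range Gamma_pullback)
      (\pi_(Gamma phiE muX) (w N)) /\
    forall x, F N x -> `|t x - w N x| <= e / 2.
  (* [w N.+1] is [s N \o phi] on [A N] and [w N] elsewhere; the form [1_A (s - w) + w] keeps it in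
     the generated submodule. *)
  pose w := fix w N := if N is N'.+1 then
    sectionD (sectionZ (mindic R (mA N')) (sectionD (section_comp (s N'))
      (sectionZ (-1) (w N')))) (w N') else section0 phiE.
  exists w; elim=> [|N [ihS ihF]]; split.
  - by move=> S [[]].
  - by rewrite /F big_ord0.
  - move=> S [subS rS]; have [S0 Sl] := subS.
    have Sw := ihS S (conj subS rS).
    rewrite /= Gamma_piD Gamma_piZ Gamma_piD Gamma_piZ.
    apply: (Sl) => //.
    rewrite addrC -Gamma_pullback_pi; apply: (Sl) => //.
    by apply: rS; exists (\pi_(Gamma E muY) (s N)).
  - move=> x; rewrite /F big_ord_recr /= -/(F N) => FA.
    rewrite (_ : mindic R (mA N) x = (x \in A N)%:R); last by rewrite -indicE.
    have [/set_mem Ax|/negP nAx] := boolP (x \in A N).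
      by rewrite scale1r scaleN1r subrK.
    rewrite scale0r add0r; apply: ihF; case: FA => // Ax.
    by case: nAx; exact/mem_set.
have cvF : muX' (F N) @[N --> \oo] --> (1%E : \bar R).
  have FT : \bigcup_n F n = setT.
    apply/seteqP; split=> // x _; have [k Ak] := covA x.
    by exists k.+1 => //; rewrite /F big_ord_recr; right.
  rewrite -(probability_setT muX') -FT; apply: nondecreasing_cvg_mu => //.
    by rewrite FT.
  by apply/nondecreasing_seqP => n; rewrite /F big_ord_recr subsetEset; left.
have [N _ hN] : \forall N \near \oo, ((1 - e / 2)%:E < muX' (F N))%E.
  apply: (cvF [set z | ((1 - e / 2)%:E < z)%E]); apply: open_nbhs_nbhs.
  by split; [exact: open_ereal_gt_ereal|rewrite /= lte_fin; lra].
exists (\pi_(Gamma phiE muX) (w N)); first by case: (hw N).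
rewrite (Gamma_distE muXX').
(* The error is at most [e / 2] on [F N]; off it the truncation bounds the integrand by 1, and [N]
   was chosen so that the complement has measure below [e / 2]. *)
apply: (@le_lt_trans _ _ ((e / 2)%:E + muX' (~` F N))%E).
  apply: L0size_bound => //; [exact: section_dist_measurable|exact: ltW|].
  apply: (ae_null_dominates muXX'.2).
  apply: filterS (Gamma_reprP muX (w N)) => x wx Fx; rewrite normr_id wx//.
  by case: (hw N) => _; apply.
have -> : (e%:E = (e / 2)%:E + (e / 2)%:E)%E by rewrite -EFinD -splitr.
rewrite lteD2lE//.
have := hN N (leqnn N); rewrite probability_setC//=.
have pF : muX' (F N) \is a fin_num by exact: fin_num_measure.
by rewrite -(fineK pF) -EFinB !lte_fin; lra.
Qed.

Lemma Gamma_pullback_is_pullback :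
  is_pullback muX' muY' phi normY normX Gamma_pullback.
Proof.
split.
- exact: Gamma_normed.
- exact: Gamma_normed.
- exact: Gamma_pullback_linear.
- exact: Gamma_pullback_norm.
- exact: Gamma_pullback_generates.
Qed.

End section_pullback.

Theorem theoremC3 (R : realType) (X Y : completeMetricType R)
  (sepX : separable X) (sepY : separable Y)
  (mX : {finite_measure set (borel X) -> \bar R})
  (mY : {finite_measure set (borel Y) -> \bar R})
  (radonX : radon mX) (radonY : radon mY)
  (mX' : probability (borel X) R) (mY' : probability (borel Y) R)
  (mXmX' : equivalent_measures mX mX') (mYmY' : equivalent_measures mY mY')
  (B : separableBanachType R) (univB : universal B)
  (phi : {mfun borel X >-> borel Y})
  (phi_mX : forall A : set (borel Y), measurable A ->
     pushforward mX phi A = mY A)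
  (E : banach_bundle B (borel Y)) :
  exists pb : Gamma E mY -> Gamma (pullback_bundle phi E) mX,
    [/\ forall s : bundle_section E,
          \forall x \ae mX, Gamma_fun (pb (\pi_(Gamma E mY) s)) x = s (phi x),
        is_pullback mX' mY' phi
          (@Gamma_norm _ _ _ _ E mY)
          (@Gamma_norm _ _ _ _ (pullback_bundle phi E) mX) pb
      & forall (N : lmodType (L0 mX)) (normN : N -> L0 mX)
               (pbN : Gamma E mY -> N),
          is_pullback mX' mY' phi (@Gamma_norm _ _ _ _ E mY) normN pbN ->
          exists Phi : {linear N -> Gamma (pullback_bundle phi E) mX},
            module_isomorphism normN
              (@Gamma_norm _ _ _ _ (pullback_bundle phi E) mX) Phi /\
            forall s, Phi (pbN s) = pb s].
Proof.
(* Preimages of [mY]-null sets are [mX]-null, so composition with [phi] is defined on classes. *)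
have phi_null A : measurable A -> mY A = 0%E -> mX (phi @^-1` A) = 0%E.
  by move=> mA A0; have := phi_mX A mA; rewrite A0.
exists (@Gamma_pullback R B _ _ _ _ phi E mX mY); split.
- move=> s; rewrite Gamma_pullback_pi//.
  by apply: filterS (Gamma_reprP mX (section_comp phi s)) => x; exact.
- exact: Gamma_pullback_is_pullback.
- move=> N normN pbN PN.
  exact: (pullback_unique mXmX' PN
    (Gamma_pullback_is_pullback E phi_null mXmX' mYmY')).
Qed.
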